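(* Let $n\geqslant 1$ and let $X=\{e,x_1,x_2\}$ be a set of three elements. Encode an $n$-valued monoid structure on $X$ with unit $e$ by the $4\times 3$ matrix $$B=\begin{pmatrix} a_0&a_1&a_2\\ b_0&b_1&b_2\\ d_0&d_1&d_2\\ c_0&c_1&c_2\end{pmatrix},$$ where $$x_1\ast x_1=a_0e+a_1x_1+a_2x_2,\quad x_1\ast x_2=b_0e+b_1x_1+b_2x_2,\quad x_2\ast x_1=d_0e+d_1x_1+d_2x_2,\quad x_2\ast x_2=c_0e+c_1x_1+c_2x_2 .$$ Then every $n$-valued monoid on the set $X$ (with unit $e$) is represented by one of the following matrices $B=B_j$, provided that all fractional expressions yield non-negative integers: $$B_1=\begin{pmatrix} a_0 & n-a_0 & 0\\ 0&0&n\\ 0&0&n\\ c_0 & \frac{c_0n}{a_0} & n-c_0-\frac{c_0n}{a_0}\end{pmatrix},$$ $$B_2=\begin{pmatrix} a_0&a_1&n-a_0-a_1\\ b_0&b_1&n-b_0-b_1\\ b_0&b_1&n-b_0-b_1\\ \frac{b_0(n-b_0-b_1)+a_0b_1-a_1b_0}{n-a_0-a_1} & \frac{(b_0+b_1)(n-b_1)}{n-a_0-a_1} & \frac{(n-b_0-b_1)^2+n(b_1-a_0-a_1)+a_1b_0-a_0b_1}{n-a_0-a_1}\end{pmatrix},$$ $$B_3=\begin{pmatrix}0&n&0\\0&n&0\\0&n&0\\c_0&c_1&n-c_0-c_1\end{pmatrix},\qquad B_4=\begin{pmatrix}0&n&0\\0&0&n\\0&0&n\\0&c_1&n-c_1\end{pmatrix},$$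 $$B_5=\begin{pmatrix}0&n&0\\0&n&0\\0&0&n\\0&0&n\end{pmatrix},\qquad B_6=\begin{pmatrix}0&n&0\\0&0&n\\0&n&0\\0&0&n\end{pmatrix}.$$ Moreover, two monoids corresponding to the series $B_i$ and $B_j$ ($i$ and $j$ not necessarily distinct, and the two monoids possibly with different values of $n$) are isomorphic if and only if the matrix $B_i$ is proportional to the matrix $B_j$ or to the matrix $\phi(B_j)$, where $\phi:X\to X$ is the isomorphism of monoids with $\phi(e)=e$, $\phi(x_1)=x_2$, $\phi(x_2)=x_1$, and $\phi(B_j)$ is the matrix of the monoid structure transported along $\phi$.
   Context: $\mathrm{Sym}^n(X)=X^{n}/S_n$ is the set of $n$-element multisets of elements of $X$; a multiset is written as a formal sum $\sum_{x\in X} m_x\, x$ with non-negative integer multiplicities, $\sum_x m_x=n$ (an element of the free commutative monoid on $X$). An $n$-valued monoid is a set $X$ with an operation $\ast:X\times X\to \mathrm{Sym}^n(X)$ such that: (associativity) for all $x,y,z\in X$ the $n^2$-multisets $[x\ast w\mid w\in y\ast z]$ and $[w\ast z\mid w\in x\ast y]$ coincide (with $w$ running with multiplicity); (unit) there is $e\in X$ with $e\ast x=x\ast e=[x,x,\dots,x]$ ($n$ times) for every $x\in X$. All entries of the matrix $B$ are multiplicities, hence non-negative integers, and each row sums to $n$. In the matrices $B_j$ the letters $a_0,a_1,b_0,b_1,c_0,c_1$ are parameters; the denominators occurring are required to be nonzero ($a_0\neq 0$ in $B_1$, $n-a_0-a_1\neq 0$ in $B_2$). The family of all matrices of the form $B_j$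 is called the series $B_j$. An $n$-valued monoid $X$ is isomorphic to an $n'$-valued monoid $X'$ if there is a bijection $\phi:X\to X'$ with $\phi(e)=e'$ and $m^{z}_{x,y}/n=m^{\phi(z)}_{\phi(x),\phi(y)}/n'$ for all $x,y,z\in X$, where $m^z_{x,y}$ is the multiplicity of $z$ in $x\ast y$. Explicitly, $\phi(B)$ is obtained from $B$ by reversing the order of the four rows and interchanging the second and third columns. Two matrices are proportional if one is a nonzero scalar multiple of the other. *)

(* Defs.v *)
From HB Require Import structures.
From mathcomp Require Import all_boot all_order all_algebra all_fingroup.
From mathcomp Require Import finmap multiset.

Set Implicit Arguments.
Unset Strict Implicit.
Unset Printing Implicit Defensive.

Import GRing.Theory Num.Theory.

Local Open Scope ring_scope.

(* Elements of Sym^n(X) are the multisets of total multiplicity n. A multiset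
   coerces to the sequence enumerating its elements with multiplicity, so that
   the big sums below are the n^2-multisets [x * w | w in y * z] and
   [w * z | w in x * y]. *)
Record nvMonoid (n : nat) (X : choiceType) := NVMonoid {
  nvmul : X -> X -> {mset X}%mset;
  nvone : X;
  size_nvmul : forall x y, size (nvmul x y) = n;
  nvmulA : forall x y z,
    \big[msetD/mset0]_(w <- nvmul y z) nvmul x w =
    \big[msetD/mset0]_(w <- nvmul x y) nvmul w z;
  nvmul1x : forall x, nvmul nvone x = msetn n x;
  nvmulx1 : forall x, nvmul x nvone = msetn n x
}.

Definition nv_isomorphic n n' (X X' : choiceType)
    (M : nvMonoid n X) (M' : nvMonoid n' X') : Prop :=
  exists phi : X -> X',
    [/\ bijective phi, phi (nvone M) = nvone M' &
        forall x y z,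
          (nvmul M x y z)%:R / n%:R
          = (nvmul M' (phi x) (phi y) (phi z))%:R / n'%:R :> rat].

(* Rows are x1 * x1, x1 * x2, x2 * x1, x2 * x2; columns are e, x1, x2. The
   entries are taken in rat so that the fractions below are genuine ones. *)
Definition nv_matrix n (X : choiceType) (M : nvMonoid n X) (e x1 x2 : X) :
    'M[rat]_(4, 3) :=
  \matrix_(i, j) (nvmul M (tnth [tuple x1; x1; x2; x2] i)
                          (tnth [tuple x1; x2; x1; x2] i)
                          (tnth [tuple e; x1; x2] j))%:R.

Definition mx_of_rows (r : seq (seq rat)) : 'M[rat]_(4, 3) :=
  \matrix_(i, j) nth 0 (nth [::] r i) j.

Definition B1 (n a0 c0 : rat) := mx_of_rows
  [:: [:: a0; n - a0; 0];
      [:: 0; 0; n];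
      [:: 0; 0; n];
      [:: c0; c0 * n / a0; n - c0 - c0 * n / a0]].

Definition B2 (n a0 a1 b0 b1 : rat) := mx_of_rows
  [:: [:: a0; a1; n - a0 - a1];
      [:: b0; b1; n - b0 - b1];
      [:: b0; b1; n - b0 - b1];
      [:: (b0 * (n - b0 - b1) + a0 * b1 - a1 * b0) / (n - a0 - a1);
          ((b0 + b1) * (n - b1)) / (n - a0 - a1);
          ((n - b0 - b1) ^+ 2 + n * (b1 - a0 - a1) + a1 * b0 - a0 * b1)
            / (n - a0 - a1)]].

Definition B3 (n c0 c1 : rat) := mx_of_rows
  [:: [:: 0; n; 0];
      [:: 0; n; 0];
      [:: 0; n; 0];
      [:: c0; c1; n - c0 - c1]].

Definition B4 (n c1 : rat) := mx_of_rows
  [:: [:: 0; n; 0];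
      [:: 0; 0; n];
      [:: 0; 0; n];
      [:: 0; c1; n - c1]].

Definition B5 (n : rat) := mx_of_rows
  [:: [:: 0; n; 0];
      [:: 0; n; 0];
      [:: 0; 0; n];
      [:: 0; 0; n]].

Definition B6 (n : rat) := mx_of_rows
  [:: [:: 0; n; 0];
      [:: 0; 0; n];
      [:: 0; n; 0];
      [:: 0; 0; n]].

(* [series n j B]: B is of the form B_j, for the given n. The parameters are
   multiplicities, hence naturals; integrality and nonnegativity of the
   remaining entries are not imposed here. *)
Variant series (n : nat) : nat -> 'M[rat]_(4, 3) -> Prop :=
  | Series1 (a0 c0 : nat) of (a0%:R != 0 :> rat) :
      series n 1 (B1 n%:R a0%:R c0%:R)
  | Series2 (a0 a1 b0 b1 : nat) of (n%:R - a0%:R - a1%:R != 0 :> rat) :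
      series n 2 (B2 n%:R a0%:R a1%:R b0%:R b1%:R)
  | Series3 (c0 c1 : nat) : series n 3 (B3 n%:R c0%:R c1%:R)
  | Series4 (c1 : nat) : series n 4 (B4 n%:R c1%:R)
  | Series5 : series n 5 (B5 n%:R)
  | Series6 : series n 6 (B6 n%:R).

Definition proportional (A B : 'M[rat]_(4, 3)) : Prop :=
  exists2 c : rat, c != 0 & A = c *: B.

(* The action on matrices of the exchange of x1 and x2. *)
Definition phi_mx (B : 'M[rat]_(4, 3)) : 'M[rat]_(4, 3) :=
  \matrix_(i, j) B (rev_ord i) (tperm 1 2%:R j).

(* The structure transported along the exchange of x1 and x2 has, with respect
   to (x1, x2), the matrix of the original one with respect to (x2, x1). *)
Lemma phi_nv_matrix n (X : choiceType) (M : nvMonoid n X) (e x1 x2 : X) :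
  phi_mx (nv_matrix M e x1 x2) = nv_matrix M e x2 x1.
Proof.
apply/matrixP => i j; rewrite !mxE.
have -> : tnth [tuple e; x1; x2] (tperm 1 2%:R j) = tnth [tuple e; x2; x1] j.
  by rewrite permE; case: j => [[|[|[|]]]].
by case: i => [[|[|[|[|]]]]].
Qed.

(* Main.v *)
Require Import Defs.
From mathcomp Require Import all_boot all_order all_algebra all_fingroup.
From mathcomp Require Import finmap multiset.
From mathcomp Require Import ring lra.

Set Implicit Arguments.
Unset Strict Implicit.
Unset Printing Implicit Defensive.

Import GRing.Theory Num.Theory.

Local Open Scope ring_scope.

(** An n-valued monoid on a finite set is the same thing as a table of
    multiplicities [m x y z] in which each product has total multiplicity [n],
    associativity is the usual quadratic identity between structure constants,
    and [e] acts as multiplication by [n] ([nv_table_of_monoid],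
    [nv_table_realized]).  Everything then takes place among rational numbers.

    Classification ([table_mx_series]).  Comparing [(x1 x1) x1] with
    [x1 (x1 x1)] gives [a2 * (x1 x2 - x2 x1) = 0].
    - If [a2 != 0], the monoid is commutative, and [(x1 x1) x2 = x1 (x1 x2)] is
      a linear equation which expresses [a2 * (x2 x2)] through the first two
      rows: this is B2.
    - If [a2 = 0], the same equation yields [n b0 + b1 b2 = 0], and here
      nonnegativity enters: [b0 = 0] and one of [b1], [b2] vanishes, so that
      [x1 x2] is [n x1] or [n x2] ([table_mul12]).  The opposite monoid shows
      the same for [x2 x1].  The two noncommutative combinations are rigid and
      give B5 and B6; the commutative ones give B3 when [x1 x2 = n x1], and B1 or
      B4, according to whether [a0] vanishes, when [x1 x2 = n x2].

    Conversely, associativity of a member of a series is needed only for triples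
    which avoid the unit ([assoc_unit]), where it is an identity of rational
    functions in the parameters ([series_nv_table]).

    Isomorphisms.  An isomorphism fixes [e], hence is the identity or the
    exchange of [x1] and [x2], and it multiplies all entries by [n / n'].
    Conversely the total of a row forces the factor of proportionality to be
    [n / n'], which is also the factor in the products by the unit
    ([isomorphic_iff_proportional]). *)

(** * Multiplicity tables *)

Section Table.

Variables (X : choiceType) (r : seq X).
Hypotheses (r_uniq : uniq r) (r_all : forall x, x \in r).

Lemma sum_indic (R : pzSemiRingType) (c : R) (x : X) (F : X -> R) :
  \sum_(z <- r) (if z == x then c else 0) * F z = c * F x.
Proof.
rewrite (bigD1_seq x) //= eqxx big1 ?addr0 // => z /negPf zx.
by rewrite zx mul0r.
Qed.

Lemma sum_over_mset (A : {mset X}%mset) (F : X -> nat) :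
  (\sum_(w <- A) F w = \sum_(w <- r) A w * F w)%N.
Proof.
rewrite sum_mset [RHS](bigID (fun w => w \in finsupp A)) /=.
rewrite [X in (_ = _ + X)%N]big1_seq ?addn0; last first.
  by move=> w /andP[/fsfun_dflt-> _].
rewrite -[RHS]big_filter; apply: perm_big; apply: uniq_perm.
- exact: fset_uniq.
- exact: filter_uniq.
- by move=> w; rewrite mem_filter r_all andbT.
Qed.

Lemma size_mset_sum (A : {mset X}%mset) : (\sum_(w <- r) A w = size A)%N.
Proof.
rewrite -sum1_size sum_over_mset.
by apply: eq_bigr => w _; rewrite muln1.
Qed.

Lemma big_msetDE (I : Type) (s : seq I) (F : I -> {mset X}%mset) u :
  ((\big[msetD/mset0]_(w <- s) F w)%mset u = \sum_(w <- s) F w u)%N.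
Proof.
by elim: s => [|w s IH]; rewrite ?big_nil ?mset0E // !big_cons msetE2 IH.
Qed.

(** The entries are rational rather than natural so that the fractions of the
    series are genuine divisions; their integrality is a separate clause. *)
Definition nv_table (n : nat) (e : X) (m : X -> X -> X -> rat) : Prop :=
  [/\ forall x y z, m x y z \is a Num.nat,
      forall x y, \sum_(z <- r) m x y z = n%:R,
      forall x y z u, \sum_(w <- r) m y z w * m x w u
                      = \sum_(w <- r) m x y w * m w z u,
      forall x z, m e x z = if z == x then n%:R else 0
    & forall x z, m x e z = if z == x then n%:R else 0].

Lemma nv_table_of_monoid n (M : nvMonoid n X) :
  nv_table n (nvone M) (fun x y z => (nvmul M x y z)%:R).
Proof.
split=> [x y z|x y|x y z u|x z|x z].
- exact: natr_nat.
- by rewrite -natr_sum size_mset_sum size_nvmul.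
- have /(congr1 (fun A : {mset X}%mset => A u)) := nvmulA M x y z.
  rewrite !big_msetDE !sum_over_mset => /(congr1 (fun k => k%:R : rat)).
  by rewrite !natr_sum; under eq_bigr do rewrite natrM;
    under [X in _ = X]eq_bigr do rewrite natrM.
- by rewrite nvmul1x msetnE; case: eqP.
- by rewrite nvmulx1 msetnE; case: eqP.
Qed.

Lemma nv_table_realized n e m : nv_table n e m ->
  exists2 M : nvMonoid n X, nvone M = e
    & forall x y z, (nvmul M x y z)%:R = m x y z.
Proof.
case=> mN msum massoc m1x mx1.
pose mul x y : {mset X}%mset :=
  (\big[msetD/mset0]_(z <- r) msetn (Num.truncn (m x y z)) z)%mset.
have mulE x y z : (mul x y z)%:R = m x y z.
  rewrite big_msetDE (bigD1_seq z) //= msetnxx big1 ?addn0 ?truncnK // => w.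
  by rewrite msetnE eq_sym => /negPf->.
have natI : injective (fun k => k%:R : rat) by apply: mulrIn; rewrite oner_eq0.
have sizeE x y : size (mul x y) = n.
  rewrite -size_mset_sum; apply: natI; rewrite natr_sum -(msum x y).
  by apply: eq_bigr => z _; rewrite mulE.
have mulA x y z :
    (\big[msetD/mset0]_(w <- mul y z) mul x w
     = \big[msetD/mset0]_(w <- mul x y) mul w z)%mset.
  apply/msetP => u; rewrite !big_msetDE !sum_over_mset; apply: natI.
  rewrite !natr_sum; under eq_bigr do rewrite natrM !mulE.
  by under [RHS]eq_bigr do rewrite natrM !mulE.
have mul1x x : mul e x = msetn n x.
  by apply/msetP => z; apply: natI; rewrite mulE m1x msetnE; case: eqP.
have mulx1 x : mul x e = msetn n x.
  by apply/msetP => z; apply: natI; rewrite mulE mx1 msetnE; case: eqP.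
by exists (NVMonoid sizeE mulA mul1x mulx1).
Qed.

(** Whichever of the three factors is the unit, both sides equal [c] times the
    same entry. *)
Lemma assoc_unit (c : rat) e (m : X -> X -> X -> rat) :
  (forall x z, m e x z = if z == x then c else 0) ->
  (forall x z, m x e z = if z == x then c else 0) ->
  forall x y z u, e \in [:: x; y; z] ->
  \sum_(w <- r) m y z w * m x w u = \sum_(w <- r) m x y w * m w z u.
Proof.
move=> m1x mx1 x y z u.
have sumr (F : X -> rat) :
    \sum_(w <- r) F w * (if u == w then c else 0) = c * F u.
  by rewrite -sum_indic; apply: eq_bigr => w _; rewrite eq_sym mulrC.
rewrite !inE => /or3P[] /eqP <-.
- under eq_bigr do rewrite m1x; under [RHS]eq_bigr do rewrite m1x.
  by rewrite sumr sum_indic.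
- under eq_bigr do rewrite m1x; under [RHS]eq_bigr do rewrite mx1.
  by rewrite !sum_indic.
- under eq_bigr do rewrite mx1; under [RHS]eq_bigr do rewrite mx1.
  by rewrite sumr sum_indic.
Qed.

Lemma nv_table_op n e m : nv_table n e m -> nv_table n e (fun x y => m y x).
Proof. by case=> mN msum massoc m1x mx1; split. Qed.

End Table.

(** * Sets of three elements *)

Section ThreeElements.

Variables (X : choiceType) (e x1 x2 : X).
Hypotheses (exx_uniq : uniq [:: e; x1; x2]).
Hypotheses (exx_all : forall x : X, x \in [:: e; x1; x2]).

Lemma distinctE :
  ((e == x1 = false) * (e == x2 = false) * (x1 == x2 = false)
   * (x1 == e = false) * (x2 == e = false) * (x2 == x1 = false))%type.
Proof.
have := exx_uniq; rewrite /= !inE negb_or andbT => /andP[/andP[h1 h2] h3].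
have F (x y : X) : x != y -> ((x == y = false) * (y == x = false))%type.
  by move=> /negPf xy; rewrite [y == x]eq_sym xy.
by rewrite !(F _ _ h1) !(F _ _ h2) !(F _ _ h3).
Qed.

Lemma sum3 (F : X -> rat) :
  \sum_(w <- [:: e; x1; x2]) F w = F e + F x1 + F x2.
Proof. by rewrite !big_cons big_nil addr0 addrA. Qed.

Lemma forall3 (P : X -> Prop) : P e -> P x1 -> P x2 -> forall x, P x.
Proof.
by move=> Pe P1 P2 x; have := exx_all x; rewrite !inE => /or3P[] /eqP->.
Qed.

Lemma forall_nonunit (P : X -> Prop) : P x1 -> P x2 -> forall x, x != e -> P x.
Proof. by move=> P1 P2; apply: forall3 => //; rewrite eqxx. Qed.

Definition table_mx (m : X -> X -> X -> rat) : 'M[rat]_(4, 3) :=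
  mx_of_rows [:: [:: m x1 x1 e; m x1 x1 x1; m x1 x1 x2];
                 [:: m x1 x2 e; m x1 x2 x1; m x1 x2 x2];
                 [:: m x2 x1 e; m x2 x1 x1; m x2 x1 x2];
                 [:: m x2 x2 e; m x2 x2 x1; m x2 x2 x2]].

Lemma nv_matrixE n (M : nvMonoid n X) :
  nv_matrix M e x1 x2 = table_mx (fun x y z => (nvmul M x y z)%:R).
Proof.
by apply/matrixP => -[[|[|[|[|//]]]] hi] [[|[|[|//]]] hj]; rewrite !mxE.
Qed.

(** * Every monoid belongs to a series *)

Section Classification.

Variables (n : nat).
Hypothesis n_gt0 : (0 < n)%N.

Let n_neq0 : n%:R != 0 :> rat. Proof. by rewrite pnatr_eq0 -lt0n. Qed.

Section TableIdentities.

Variable m : X -> X -> X -> rat.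
Hypothesis m_table : nv_table [:: e; x1; x2] n e m.

Lemma table_sum x y : m x y e + m x y x1 + m x y x2 = n%:R.
Proof. by rewrite -sum3; case: m_table. Qed.

Lemma table_assoc x y z u :
  m y z e * (if u == x then n%:R else 0)
    + m y z x1 * m x x1 u + m y z x2 * m x x2 u
  = m x y e * (if u == z then n%:R else 0)
    + m x y x1 * m x1 z u + m x y x2 * m x2 z u.
Proof.
case: m_table => _ _ /(_ x y z u) A m1x mx1.
by move: A; rewrite !sum3 m1x mx1.
Qed.

(** In [x1 (x1 x1) = (x1 x1) x1] only the [x2]-component of [x1 x1] can fail to
    commute with [x1]. *)
Lemma table_commutator1 u : m x1 x1 x2 * (m x1 x2 u - m x2 x1 u) = 0.
Proof. by have := table_assoc x1 x1 x1 u; lra. Qed.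

Lemma table_commutator2 u : m x2 x2 x1 * (m x1 x2 u - m x2 x1 u) = 0.
Proof. by have := table_assoc x2 x2 x2 u; lra. Qed.

(** If [e] and [x1] span a subalgebra, the coefficient of [x1] in
    [x1 (x1 x2) = (x1 x1) x2] says that [n * b0 + b1 * b2 = 0] for
    [x1 x2 = b0 e + b1 x1 + b2 x2]; both summands are nonnegative. *)
Lemma table_mul12 : m x1 x1 x2 = 0 ->
  m x1 x2 e = 0 /\
  (m x1 x2 x1 = n%:R /\ m x1 x2 x2 = 0 \/ m x1 x2 x1 = 0 /\ m x1 x2 x2 = n%:R).
Proof.
move=> a2; have mN x y z : 0 <= m x y z.
  by rewrite natr_ge0; case: m_table.
have := table_assoc x1 x1 x2 x1; rewrite a2 eqxx distinctE => E1.
have p0 := mulr_ge0 (mN x1 x2 e) (ler0n _ n).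
have p12 := mulr_ge0 (mN x1 x2 x1) (mN x1 x2 x2).
have b0 : m x1 x2 e = 0 by apply: (mulIf n_neq0); lra.
have /eqP : m x1 x2 x1 * m x1 x2 x2 = 0 by lra.
have := table_sum x1 x2; rewrite b0 mulf_eq0 => s /orP[] /eqP b.
  by split=> //; right; split; lra.
by split=> //; left; split; lra.
Qed.

End TableIdentities.

Local Ltac entrywise :=
  congr (mx_of_rows
    [:: [:: _; _; _]; [:: _; _; _]; [:: _; _; _]; [:: _; _; _]]).

Lemma table_mx_series m : nv_table [:: e; x1; x2] n e m ->
  exists j, series n j (table_mx m).
Proof.
move=> T; have nat_entry x y z : exists k : nat, m x y z = k%:R.
  by apply/natrP; case: T.
have [a0 Ea0] := nat_entry x1 x1 e; have [a1 Ea1] := nat_entry x1 x1 x1.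
have [b0 Eb0] := nat_entry x1 x2 e; have [b1 Eb1] := nat_entry x1 x2 x1.
have [c0 Ec0] := nat_entry x2 x2 e; have [c1 Ec1] := nat_entry x2 x2 x1.
have sa := table_sum T x1 x1; have sb := table_sum T x1 x2.
have sc := table_sum T x2 x2.
have := (table_assoc T x1 x1 x2 e, table_assoc T x1 x1 x2 x1,
         table_assoc T x1 x1 x2 x2).
rewrite !eqxx !distinctE => -[[A0 A1] A2].
case: (eqVneq (m x1 x1 x2) 0) => [a2|a2_neq0]; last first.
  have comm u : m x2 x1 u = m x1 x2 u.
    have := table_commutator1 T u; move/eqP.
    by rewrite mulf_eq0 (negPf a2_neq0) subr_eq0 => /eqP.
  have a2E : m x1 x1 x2 = n%:R - m x1 x1 e - m x1 x1 x1 by lra.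
  exists 2%N; have -> : table_mx m = B2 n%:R a0%:R a1%:R b0%:R b1%:R.
    rewrite -Ea0 -Ea1 -Eb0 -Eb1 /B2 -a2E /table_mx !comm.
    have b2E : m x1 x2 x2 = n%:R - m x1 x2 e - m x1 x2 x1 by lra.
    have c2E : m x2 x2 x2 = n%:R - m x2 x2 e - m x2 x2 x1 by lra.
    (* A0, A1, A2 are linear in the last row, with coefficient a2. *)
    entrywise => //.
    - rewrite -[LHS](mulfK a2_neq0); congr (_ / _).
      by rewrite -b2E; lra.
    - rewrite -[LHS](mulfK a2_neq0); congr (_ / _).
      by move: A1; rewrite b2E; lra.
    - rewrite -[LHS](mulfK a2_neq0); congr (_ / _).
      by rewrite c2E; move: A0 A1 A2; rewrite b2E a2E; lra.
  by constructor; rewrite -Ea0 -Ea1 -a2E.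
have [b0E bE] := table_mul12 T a2.
have [/= d0E dE] := table_mul12 (nv_table_op T) a2.
have K := table_commutator2 T x1.
have := (table_assoc T x1 x2 x2 e, table_assoc T x2 x2 x1 e,
         table_assoc T x2 x1 x1 e).
rewrite !distinctE => -[[C0 C1] D0].
rewrite a2 b0E d0E in A0 C0 C1 D0.
case: bE dE K => [[b1E b2E]|[b1E b2E]] [[d1E d2E]|[d1E d2E]] K;
  rewrite b1E b2E d1E d2E in A0 C0 C1 D0 K.
- (* x1 x2 = x2 x1 = n x1 *)
  have a0E : m x1 x1 e = 0 by apply: (mulfI n_neq0); lra.
  exists 3%N; have -> : table_mx m = B3 n%:R c0%:R c1%:R; last by constructor.
  rewrite -Ec0 -Ec1 /table_mx a0E a2 b0E b1E b2E d0E d1E d2E /B3.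
  by entrywise; lra.
- (* x1 x2 = n x1, x2 x1 = n x2 *)
  have a0E : m x1 x1 e = 0 by apply: (mulfI n_neq0); lra.
  have c1E : m x2 x2 x1 = 0 by apply: (mulIf n_neq0); lra.
  have c0E : m x2 x2 e = 0.
    by apply: (mulfI n_neq0); move: C1; rewrite c1E; lra.
  exists 5%N; have -> : table_mx m = B5 n%:R; last by constructor.
  rewrite /table_mx a0E a2 b0E b1E b2E d0E d1E d2E c0E c1E /B5.
  by entrywise; lra.
- (* x1 x2 = n x2, x2 x1 = n x1 *)
  have a0E : m x1 x1 e = 0 by apply: (mulfI n_neq0); lra.
  have c1E : m x2 x2 x1 = 0 by apply: (mulIf n_neq0); lra.
  have c0E : m x2 x2 e = 0.
    by apply: (mulfI n_neq0); move: C0; rewrite c1E; lra.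
  exists 6%N; have -> : table_mx m = B6 n%:R; last by constructor.
  rewrite /table_mx a0E a2 b0E b1E b2E d0E d1E d2E c0E c1E /B6.
  by entrywise; lra.
(* x1 x2 = x2 x1 = n x2 *)
have c1a0 : m x2 x2 x1 * m x1 x1 e = m x2 x2 e * n%:R by lra.
case: (eqVneq (m x1 x1 e) 0) => [a0E|a0_neq0].
  have c0E : m x2 x2 e = 0 by apply: (mulIf n_neq0); rewrite -c1a0 a0E; lra.
  exists 4%N; have -> : table_mx m = B4 n%:R c1%:R; last by constructor.
  rewrite -Ec1 /table_mx a0E a2 b0E b1E b2E d0E d1E d2E c0E /B4.
  by entrywise; lra.
exists 1%N; have -> : table_mx m = B1 n%:R a0%:R c0%:R.
  rewrite -Ea0 -Ec0 /B1 -c1a0 mulfK // /table_mx a2 b0E b1E b2E d0E d1E d2E.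
  by entrywise; lra.
by constructor; rewrite -Ea0.
Qed.

End Classification.

(** * Every member of a series is a monoid *)

(** The row of the product [x y] is the number with base-two digits given by
    [x] and [y], [x1] standing for 0 and [x2] for 1. *)
Definition table_of_mx (c : rat) (B : 'M[rat]_(4, 3)) (x y z : X) : rat :=
  if x == e then if z == y then c else 0 else
  if y == e then if z == x then c else 0 else
  B (inord (index x [:: x1; x2] * 2 + index y [:: x1; x2]))
    (inord (index z [:: e; x1; x2])).

Lemma series_nv_table n j B : series n j B -> B \is a mxOver Num.nat ->
  nv_table [:: e; x1; x2] n e (table_of_mx n%:R B).
Proof.
move=> sB /mxOverP BN; set m := table_of_mx _ _.
have m1x x z : m e x z = if z == x then n%:R else 0.
  by rewrite /m /table_of_mx eqxx.
have mx1 x z : m x e z = if z == x then n%:R else 0.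
  by rewrite /m /table_of_mx eqxx; case: (eqVneq x e) => [->|].
have m_sum x y : \sum_(z <- [:: e; x1; x2]) m x y z = n%:R.
  case: (eqVneq x e) => [->|].
    under eq_bigr do rewrite m1x -[if _ then _ else _]mulr1.
    by rewrite sum_indic ?mulr1.
  case: (eqVneq y e) => [-> _|].
    under eq_bigr do rewrite mx1 -[if _ then _ else _]mulr1.
    by rewrite sum_indic ?mulr1.
  move: y; apply: forall_nonunit; move: x; apply: forall_nonunit; rewrite sum3;
    rewrite /m /table_of_mx /= ?eqxx ?distinctE /= {m1x mx1 BN};
    case: sB => *; rewrite /B1 /B2 /B3 /B4 /B5 /B6 /mx_of_rows;
    by rewrite !mxE !inordK //=; field.
have m_assoc x y z u :
    \sum_(w <- [:: e; x1; x2]) m y z w * m x w u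
    = \sum_(w <- [:: e; x1; x2]) m x y w * m w z u.
  case: (boolP (e \in [:: x; y; z])) => [he|].
    exact: (assoc_unit exx_uniq exx_all m1x mx1).
  rewrite !inE !(eq_sym e) !negb_or => /and3P[].
  move: x; apply: forall_nonunit; move: y; apply: forall_nonunit;
    move: z; apply: forall_nonunit; move: u; apply: forall3;
    rewrite !sum3 !m1x !mx1 ?eqxx ?distinctE;
    rewrite /m /table_of_mx /= ?eqxx ?distinctE /= {m1x mx1 BN};
    case: sB => *; rewrite /B1 /B2 /B3 /B4 /B5 /B6 /mx_of_rows;
    by rewrite !mxE !inordK //=; field.
split=> // x y z; rewrite /m /table_of_mx.
by do ![case: ifP => _] => //; rewrite ?natr_nat ?rpred0.
Qed.

Lemma series_realized n j B : series n j B -> B \is a mxOver Num.nat ->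
  exists2 M : nvMonoid n X, nvone M = e & nv_matrix M e x1 x2 = B.
Proof.
move=> sB BN; have [M M1 mulE] :=
  nv_table_realized exx_uniq exx_all (series_nv_table sB BN).
exists M => //; apply/matrixP => i k; rewrite mxE mulE /table_of_mx.
case: i k => [[|[|[|[|//]]]] hi] [[|[|[|//]]] hk];
  rewrite !(tnth_nth e) /= ?eqxx !distinctE /=;
  by congr (B _ _); apply/val_inj; rewrite /= inordK.
Qed.

(** * Isomorphisms *)

Lemma isomorphism_proportional n n' (M : nvMonoid n X) (M' : nvMonoid n' X)
    (phi : X -> X) :
  (0 < n)%N -> (0 < n')%N ->
  (forall x y z, (nvmul M x y z)%:R / n%:R
    = (nvmul M' (phi x) (phi y) (phi z))%:R / n'%:R :> rat) ->
  proportional (nv_matrix M e x1 x2) (nv_matrix M' (phi e) (phi x1) (phi x2)).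
Proof.
rewrite -!(ltr0n rat) => n_gt0 n'_gt0 phiM; exists (n%:R / n'%:R).
  by rewrite mulf_neq0 ?invr_eq0 ?lt0r_neq0.
have scale x y z : (nvmul M x y z)%:R
    = n%:R / n'%:R * (nvmul M' (phi x) (phi y) (phi z))%:R :> rat.
  by rewrite -mulrA [_^-1 * _]mulrC -phiM mulrC divfK ?lt0r_neq0.
apply/matrixP => -[[|[|[|[|//]]]] hi] [[|[|[|//]]] hk]; rewrite !mxE;
  exact: scale.
Qed.

Lemma proportional_isomorphism n n' (M : nvMonoid n X) (M' : nvMonoid n' X)
    (phi : X -> X) :
  (0 < n)%N -> (0 < n')%N -> nvone M = e -> nvone M' = e ->
  bijective phi -> phi e = e ->
  proportional (nv_matrix M e x1 x2) (nv_matrix M' e (phi x1) (phi x2)) ->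
  nv_isomorphic M M'.
Proof.
rewrite -!(ltr0n rat) => n_gt0 n'_gt0 M1 M'1 phi_bij phi_e [c c_neq0 MM'].
exists phi; split=> //; first by rewrite M1 M'1.
have scale x y z : x != e -> y != e ->
    (nvmul M x y z)%:R = c * (nvmul M' (phi x) (phi y) (phi z))%:R :> rat.
  have entry i k := congr1 (fun B : 'M_(4, 3) => B i k) MM'.
  move: x; apply: forall_nonunit; move: y; apply: forall_nonunit;
    move: z; apply: forall3; rewrite ?phi_e;
    [ have := entry 0 0     | have := entry 0 1     | have := entry 0 2%:R
    | have := entry 1 0     | have := entry 1 1     | have := entry 1 2%:R
    | have := entry 2%:R 0  | have := entry 2%:R 1  | have := entry 2%:R 2%:R
    | have := entry 3%:R 0  | have := entry 3%:R 1  | have := entry 3%:R 2%:R ];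
    by rewrite !mxE !(tnth_nth e).
(* The products x1 x1 and phi x1 phi x1 have total multiplicities n and n'. *)
have c_ratio : c * n'%:R = n%:R.
  pose r := [:: e; x1; x2]; have [g gK phiK] := phi_bij.
  have pr_uniq : uniq (map phi r) by rewrite map_inj_uniq //; exact: can_inj gK.
  have pr_all x : x \in map phi r by rewrite -(phiK x) map_f.
  rewrite -(size_nvmul M' (phi x1) (phi x1)) -(size_nvmul M x1 x1).
  rewrite -(size_mset_sum pr_uniq pr_all) -(size_mset_sum exx_uniq exx_all).
  rewrite !natr_sum mulr_sumr big_map; apply: eq_bigr => z _.
  by rewrite scale ?distinctE.
have unit_ratio x y : (msetn n x y)%:R / n%:R
    = (msetn n' (phi x) (phi y))%:R / n'%:R :> rat.
  rewrite !msetnE (inj_eq (bij_inj phi_bij)).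
  by case: ifP => _; rewrite ?mul0r // !divff ?lt0r_neq0.
move=> x y z; case: (eqVneq x e) => [->|x_neq_e].
  by rewrite phi_e -{1}M1 -M'1 !nvmul1x.
case: (eqVneq y e) => [->|y_neq_e].
  by rewrite phi_e -{1}M1 -M'1 !nvmulx1.
by rewrite scale // -c_ratio invfM mulrACA divff // mul1r.
Qed.

Lemma isomorphic_iff_proportional n n'
    (M : nvMonoid n X) (M' : nvMonoid n' X) :
  (0 < n)%N -> (0 < n')%N -> nvone M = e -> nvone M' = e ->
  nv_isomorphic M M' <->
  proportional (nv_matrix M e x1 x2) (nv_matrix M' e x1 x2) \/
  proportional (nv_matrix M e x1 x2) (phi_mx (nv_matrix M' e x1 x2)).
Proof.
move=> n_gt0 n'_gt0 M1 M'1; rewrite phi_nv_matrix; split.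
  case=> phi [phi_bij]; rewrite M1 M'1 => phi_e phiM.
  have := isomorphism_proportional n_gt0 n'_gt0 phiM; rewrite phi_e.
  have := exx_all (phi x2); have := exx_all (phi x1).
  have phi_eq := inj_eq (bij_inj phi_bij).
  have phi_neq x : (phi x == e) = (x == e) by rewrite -{1}phi_e phi_eq.
  rewrite !inE !phi_neq !distinctE /= => /orP[] /eqP p1 /orP[] /eqP p2;
    have := phi_eq x1 x2; rewrite p1 p2 ?eqxx ?distinctE //;
    by [left|right].
pose swap x := if x == x1 then x2 else if x == x2 then x1 else x.
have [swap_e swap_1 swap_2] : [/\ swap e = e, swap x1 = x2 & swap x2 = x1].
  by rewrite /swap !eqxx !distinctE.
case=> MM'.
  by apply: (@proportional_isomorphism _ _ _ _ id) => //; exists id.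
apply: (@proportional_isomorphism _ _ _ _ swap) => //.
  by exists swap; apply: forall3; rewrite ?(swap_e, swap_1, swap_2).
by rewrite swap_1 swap_2.
Qed.

End ThreeElements.

Theorem mainTheorem1 (n : nat) (hn : (0 < n)%N) (X : choiceType) (e x1 x2 : X)
    (hdistinct : uniq [:: e; x1; x2])
    (hX : forall x : X, x \in [:: e; x1; x2]) :
  [/\ (* every monoid belongs to one of the series *)
      forall M : nvMonoid n X, nvone M = e ->
        exists j : nat, series n j (nv_matrix M e x1 x2),
      (* every member of a series with natural entries is a monoid *)
      forall (j : nat) (B : 'M[rat]_(4, 3)), series n j B ->
        B \is a mxOver Num.nat ->
        exists2 M : nvMonoid n X, nvone M = e & nv_matrix M e x1 x2 = B
    & forall (n' : nat) (M : nvMonoid n X) (M' : nvMonoid n' X) (i j : nat),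
        (0 < n')%N -> nvone M = e -> nvone M' = e ->
        series n i (nv_matrix M e x1 x2) ->
        series n' j (nv_matrix M' e x1 x2) ->
        nv_isomorphic M M' <->
        proportional (nv_matrix M e x1 x2) (nv_matrix M' e x1 x2) \/
        proportional (nv_matrix M e x1 x2) (phi_mx (nv_matrix M' e x1 x2))].
Proof.
split=> [M M1|j B|n' M M' i j n'_gt0 M1 M'1 _ _].
- rewrite nv_matrixE; apply: table_mx_series => //.
  by have := nv_table_of_monoid hdistinct hX M; rewrite M1.
- exact: series_realized.
- exact: isomorphic_iff_proportional.
Qed.
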